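(* Let $q$, $\Xi=\{\xi_j\}_{j\ge0}$, $S=\{s_j\}_{j\ge0}$ be generic nonzero complex parameters. 1. For any $M\ge0$, $\mu\in\mathrm{Sign}_M^+$ and (generic) $u_1,\dots,u_M\in\mathbb C$, $$F_\mu(u_1,\dots,u_M\,|\,\Xi,S)=\sum_{\sigma\in\mathfrak S_M}\sigma\Bigg(\prod_{1\le\alpha<\beta\le M}\frac{u_\alpha-qu_\beta}{u_\alpha-u_\beta}\prod_{i=1}^M\varphi_{\mu_i}(u_i\,|\,\Xi,S)\Bigg),$$ where $\sigma$ acts by permuting the $u_i$. 2. Let $n\ge0$, $\nu\in\mathrm{Sign}_n^+$, and let $k$ be the number of zero coordinates of $\nu$. Then for any $N\ge n-k$ and (generic) $v_1,\dots,v_N\in\mathbb C$, $$G_\nu(v_1,\dots,v_N\,|\,\Xi,S)=\frac{(s_0^2;q)_n}{(q;q)_{N-n+k}(s_0^2;q)_k}\sum_{\sigma\in\mathfrak S_N}\sigma\Bigg(\prod_{1\le\alpha<\beta\le N}\frac{v_\alpha-qv_\beta}{v_\alpha-v_\beta}\prod_{j=1}^N\varphi_{\nu_j}(v_j\,|\,\Xi,S)\prod_{i=1}^{n-k}\frac{\xi_0v_i}{\xi_0v_i-s_0}\prod_{j=n-k+1}^{N}(1-s_0q^k\xi_0v_j)\Bigg),$$ where $\sigma$ permutes the $v_j$ and, by agreement, $\nu_j=0$ for $j>n$. If $N<n-k$, then $G_\nu(v_1,\dots,v_N\,|\,\Xi,S)=0$.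
   Context: $\mathrm{Sign}_N^+$ is the set of integer sequences $\lambda_1\ge\dots\ge\lambda_N\ge0$; $m_x(\lambda)$ is the number of parts of $\lambda$ equal to $x$. $(z;q)_m=\prod_{i=0}^{m-1}(1-zq^i)$. ''Generic'' means no denominators occurring vanish. $$\varphi_k(u\,|\,\Xi,S)=\frac{1-q}{1-s_k\xi_ku}\prod_{j=0}^{k-1}\frac{\xi_ju-s_j}{1-s_j\xi_ju},\qquad k\ge0.$$ Vertex weights: for $g\in\mathbb Z_{\ge0}$, $w_{u,s}(g,0;g,0)=\frac{1-sq^gu}{1-su}$, $w_{u,s}(g+1,0;g,1)=\frac{(1-s^2q^g)u}{1-su}$, $w_{u,s}(g,1;g,1)=\frac{u-sq^g}{1-su}$, $w_{u,s}(g,1;g+1,0)=\frac{1-q^{g+1}}{1-su}$; all other $w_{u,s}(i_1,j_1;i_2,j_2)$ are $0$. Partition functions. Given $\lambda,\mu$ and $n\ge0$, consider arrow configurations on $\mathbb Z_{\ge0}\times\{1,\dots,n\}$: nonnegative integers $a_y(x)$ ($0\le y\le n$, $x\ge0$; number of vertical arrows from $(x,y)$ to $(x,y+1)$) and $h_y(x)\in\{0,1\}$ ($1\le y\le n$, $x\ge0$; number of horizontal arrows from $(x-1,y)$ to $(x,y)$), finitely many of them nonzero, with $a_0(x)=m_x(\lambda)$, $a_n(x)=m_x(\mu)$. The weight of a configuration is $\prod_{y=1}^n\prod_{x\ge0}w_{\xi_xu_y,s_x}(a_{y-1}(x),h_y(x);a_y(x),h_y(x+1))$. $G_{\mu/\lambda}(u_1,\dots,u_n\,|\,\Xi,S)$,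 for $\lambda,\mu\in\mathrm{Sign}_N^+$, is the sum of weights over configurations with $h_y(0)=0$ for all $y$. $F_{\mu/\lambda}(u_1,\dots,u_n\,|\,\Xi,S)$, for $\lambda\in\mathrm{Sign}_N^+$, $\mu\in\mathrm{Sign}_{N+n}^+$, is the sum over configurations with $h_y(0)=1$ for all $y$. (Equivalently, sums over collections of up-right lattice paths.) Abbreviate $F_\mu=F_{\mu/\varnothing}$, and $G_\nu=G_{\nu/(0,\dots,0)}$ for $\nu\in\mathrm{Sign}_n^+$ (with $n$ zeros). *)

(* Defs.v *)
From HB Require Import structures.
From mathcomp Require Import all_boot all_order all_algebra all_fingroup.
From mathcomp Require Import all_classical all_reals.
From mathcomp Require Export complex.

Set Implicit Arguments.
Unset Strict Implicit.
Unset Printing Implicit Defensive.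

Import GRing.Theory.
Local Open Scope classical_set_scope.
Local Open Scope ring_scope.

(* All indices are 0-based: the i-th part of l is [nth 0 l i], which is 0 past
   the end of l. *)
Definition signature (N : nat) : Type :=
  {l : N.-tuple nat | sorted geq l}.

Definition parts (N : nat) (la : signature N) : seq nat := tval (val la).

Definition mult (N : nat) (x : nat) (la : signature N) : nat :=
  count_mem x (parts la).

Lemma sorted_nseq0 (N : nat) : sorted geq (nseq_tuple N 0%N).
Proof. by case: N => //= N; elim: N => //= N ->; rewrite /geq /= leqnn. Qed.

Definition zeros (N : nat) : signature N :=
  exist (fun l : N.-tuple nat => sorted geq l) (nseq_tuple N 0%N)
    (sorted_nseq0 N).

Section HigherSpin.
Context {F : fieldType}.

Definition qpoch (z q : F) (m : nat) : F := \prod_(i < m) (1 - z * q ^+ i).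

Definition phi (q : F) (xi s : nat -> F) (k : nat) (u : F) : F :=
  (1 - q) / (1 - s k * xi k * u) *
  \prod_(j < k) ((xi j * u - s j) / (1 - s j * xi j * u)).

Definition vertex_weight (q u s : F) (i1 : nat) (j1 : bool)
    (i2 : nat) (j2 : bool) : F :=
  match j1, j2 with
  | false, false => if i1 == i2 then (1 - s * q ^+ i1 * u) / (1 - s * u) else 0
  | false, true =>
      if i1 == i2.+1 then (1 - s ^+ 2 * q ^+ i2) * u / (1 - s * u) else 0
  | true, true => if i1 == i2 then (u - s * q ^+ i1) / (1 - s * u) else 0
  | true, false => if i2 == i1.+1 then (1 - q ^+ i1.+1) / (1 - s * u) else 0
  end.

(* A pair (a, h): a y x for 0 <= y <= n, and h y x for the row y + 1, y < n. *)
Definition config (n : nat) : Type :=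
  (('I_n.+1 -> nat -> nat) * ('I_n -> nat -> bool))%type.

Definition configs (n K L : nat) (la : signature K) (mu : signature L)
    (b : bool) : set (config n) :=
  [set c : config n |
           [/\ finite_set [set p : 'I_n.+1 * nat | c.1 p.1 p.2 <> 0%N],
               finite_set [set p : 'I_n * nat | c.2 p.1 p.2 = true],
               forall x, c.1 ord0 x = mult x la,
               forall x, c.1 ord_max x = mult x mu
             & forall y, c.2 y 0%N = b]].

(* The product over all x >= 0 has finitely many factors different from 1 as
   soon as no denominator 1 - s x * xi x * u y vanishes. *)
Definition config_weight (q : F) (xi s : nat -> F) (n : nat) (u : 'I_n -> F)
    (c : config n) : F :=
  \prod_(y < n) \big[*%R/1]_(x \in [set: nat])
    vertex_weight q (xi x * u y) (s x)
      (c.1 (inord y) x) (c.2 y x) (c.1 (inord y.+1) x) (c.2 y x.+1).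

Definition skewG (q : F) (xi s : nat -> F) (N n : nat)
    (mu la : signature N) (u : 'I_n -> F) : F :=
  \sum_(c \in @configs n N N la mu false) config_weight q xi s u c.

Definition skewF (q : F) (xi s : nat -> F) (N n : nat)
    (mu : signature (N + n)) (la : signature N) (u : 'I_n -> F) : F :=
  \sum_(c \in @configs n N (N + n) la mu true) config_weight q xi s u c.

Definition Ffun (q : F) (xi s : nat -> F) (M : nat) (mu : signature M)
    (u : 'I_M -> F) : F :=
  @skewF q xi s 0 M mu (zeros 0) u.

Definition Gfun (q : F) (xi s : nat -> F) (n N : nat) (nu : signature n)
    (v : 'I_N -> F) : F :=
  @skewG q xi s n N nu (zeros n) v.

Definition symmetrize (n : nat) (f : ('I_n -> F) -> F) (u : 'I_n -> F) : F :=
  \sum_(sg : 'S_n) f (fun i => u (sg i)).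

Definition cross (q : F) (n : nat) (u : 'I_n -> F) : F :=
  \prod_(a < n) \prod_(b < n | (a < b)%N) ((u a - q * u b) / (u a - u b)).

End HigherSpin.

(* Main.v *)
Require Import Defs.
From HB Require Import structures.
From mathcomp Require Import all_boot all_algebra all_fingroup.
From mathcomp Require Import all_classical all_reals.
From mathcomp Require Import complex ring.

(* Let A(u) and B(u) be the transfer operators of one row whose leftmost
   horizontal edge is empty, resp. occupied.  The A's commute, the B's commute,
   and, with c(u, v) = (u - q v) / (u - v),
     A(u) B(v) = c(v, u) B(v) A(u) + (1 - c(v, u)) B(u) A(v).
   F is a matrix element of B(u_M) ... B(u_1) on the vacuum.  Let E remove an
   arrow from the leftmost column, whose parameters are xi and s; then
     E B(v) = (q - s xi v)/(1 - s xi v) B(v) E + (1 - q)/(1 - s xi v) A(v),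
   and commuting E through the B's removes one smallest part of mu together
   with one of the u's.  Choosing the variable in the last position of the
   symmetrization leads to the same recursion.
   G is a matrix element of A(v_N) ... A(v_1) on n arrows in column 0.  Write
   A'(v) for q^(arrows in the leftmost column) times A(v) on the other columns,
   and M(w, v) for A with parameter w in the leftmost column and v in the other
   ones.  Then
     q A'(v) A(w) = c(w, v) A(w) A'(v) + (q - c(w, v)) M(w, v) A'(w),
     c(w, p) M(p, v) A(w) =
       c(w, v) A(w) M(p, v) + (c(w, p) - c(w, v)) M(w, v) M(p, w),
   and they give a recursion removing one of the v's, down to N = n - k, where
   every row carries an arrow out of column 0 and G is a multiple of an F on
   the columns x >= 1. *)

Set Implicit Arguments.
Unset Strict Implicit.
Unset Printing Implicit Defensive.

Import GRing.Theory.
Local Open Scope ring_scope.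

Lemma neq_subr (V : zmodType) (x y : V) : x != y -> x - y != 0 /\ y - x != 0.
Proof. by rewrite !subr_eq0 (eq_sym y). Qed.

Lemma scaleCA (R : comPzRingType) (V : lmodType R) (a b : R) (x : V) :
  a *: (b *: x) = b *: (a *: x).
Proof. by rewrite !scalerA mulrC. Qed.

Fixpoint picks (T : Type) (r : seq T) : seq (T * seq T) :=
  if r is x :: r' then (x, r') :: [seq (z.1, x :: z.2) | z <- picks r']
  else [::].

Lemma perm_picks (T : eqType) (r : seq T) z :
  z \in picks r -> perm_eq (z.1 :: z.2) r.
Proof.
elim: r z => //= x r IH z.
rewrite inE => /predU1P[-> //|/mapP[z' /IH perm_z' ->]] /=.
by rewrite -(cat1s z'.1) -(cat1s x) perm_catCA /= perm_cons.
Qed.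

Lemma codom_ordS (T : Type) n (u : 'I_n.+1 -> T) :
  codom u = u ord0 :: codom (u \o lift ord0).
Proof. by rewrite !codomE enum_ordSl /= -map_comp. Qed.

Lemma picks_codom (T : Type) n (u : 'I_n.+1 -> T) :
  picks (codom u) = [seq (u j, codom (u \o lift j)) | j <- enum 'I_n.+1].
Proof.
elim: n u => [|n IH] u; rewrite codom_ordS enum_ordSl /= -map_comp.
  by rewrite !codomE !enum_ord0.
rewrite {}IH -map_comp; congr (_ :: _); apply: eq_map => j /=; congr (_, _).
rewrite (codom_ordS (u \o _)) /=; congr (u _ :: _); first exact: val_inj.
rewrite !codomE; apply: eq_map => i; congr u; apply: val_inj => /=.
by rewrite /bump /= !add1n ltnS addnS.
Qed.

Lemma big_lift_perm (R : Type) (idx : R) (op : Monoid.com_law idx) n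
    (i : 'I_n.+1) (G : 'S_n.+1 -> R) :
  \big[op/idx]_p G p =
  \big[op/idx]_j \big[op/idx]_(p : 'S_n) G (lift_perm i j p).
Proof.
pose L (z : 'I_n.+1 * 'S_n) := lift_perm i z.1 z.2.
have injL : injective L.
  move=> [j p] [j' p'] /permP eqL; have eq_j : j = j'.
    by have := eqL i; rewrite /L !lift_perm_id.
  congr (_, _) => //; apply/permP => k; apply: (@lift_inj _ j).
  by have := eqL (lift i k); rewrite /L /= !lift_perm_lift -eq_j.
have bijL : bijective L.
  by apply: inj_card_bij => //; rewrite card_prod card_ord !card_Sn factS.
rewrite (reindex L) /=; last exact: onW_bij.
by rewrite -(pair_bigA _ (fun j p => G (lift_perm i j p))).
Qed.

Lemma big_tuple0 (R : Type) (idx : R) (op : Monoid.law idx) (T : finType)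
    (G : 0.-tuple T -> R) :
  \big[op/idx]_t G t = G [tuple].
Proof. by apply: big_pred1 => t; apply/esym/eqP/tuple0. Qed.

Lemma big_tuple_cons (R : Type) (idx : R) (op : Monoid.com_law idx)
    (T : finType) n (G : n.+1.-tuple T -> R) :
  \big[op/idx]_t G t =
  \big[op/idx]_x \big[op/idx]_(t : n.-tuple T) G [tuple of x :: t].
Proof.
pose cons_pair (z : T * n.-tuple T) := [tuple of z.1 :: z.2].
rewrite pair_bigA (reindex cons_pair) //=.
apply: onW_bij; exists (fun t => (thead t, [tuple of behead t])) => [[x t]|t].
  by rewrite /= theadE; congr (_, _); apply: val_inj.
by rewrite /cons_pair /= -tuple_eta.
Qed.

Lemma mkseq_cons (T : Type) (f : nat -> T) n :
  mkseq f n.+1 = f 0%N :: mkseq (f \o S) n.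
Proof. by rewrite /mkseq /= (iotaDl 1 0) -map_comp. Qed.

(** * Transfer operators *)

Section TransferOperators.
Context {F : fieldType} (q : F) (xi s : nat -> F).
Implicit Types (x b k n m : nat) (u v w p : F) (j : bool) (us vs : seq F)
  (bs cs : seq nat) (f g : seq nat -> F^o).

Definition den x u := 1 - s x * xi x * u.

Definition regular u := forall x, den x u != 0.

Definition cross_factor u v := (u - q * v) / (u - v).

(* The sum over all rows whose columns, numbered from [x] on, carry [bs] above
   the row and whose leftmost edge is [j]; [f] is evaluated at the occupation
   numbers below the row.  The truncated subtraction is harmless, as the
   vertex weight vanishes at [b + j' < j]. *)
Fixpoint transfer x j u f bs {struct bs} : F^o :=
  match bs with
  | [::] => if j then 0 else f [::]
  | b :: bs' => \sum_(j' : bool)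
      vertex_weight q (xi x * u) (s x) (b + j' - j) j b j'
        * transfer x.+1 j' u (f \o cons (b + j' - j)%N) bs'
  end.

Local Notation opA x := (transfer x false).
Local Notation opB x := (transfer x true).

Lemma transfer_linear x j u : linear (transfer x j u).
Proof.
move=> a f g; apply/funext => bs.
suff: transfer x j u (a *: f + g) bs =
  a * transfer x j u f bs + transfer x j u g bs by [].
elim: bs x j f g => [|b bs IH] x j f g /=.
  by case: j; rewrite ?mulr0 ?addr0.
rewrite mulr_sumr -big_split; apply: eq_bigr => j' _ /=.
by rewrite mulrCA -mulrDr -IH.
Qed.

HB.instance Definition _ x j u :=
  GRing.isLinear.Build F (seq nat -> F^o) (seq nat -> F^o) _ _
    (transfer_linear x j u).

(* These instances of the generic lemmas are keyed on [transfer], which makes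
   rewriting with them much faster. *)
Lemma transferD x j u : {morph transfer x j u : f g / f + g}.
Proof. exact: linearD. Qed.

Lemma transferZ x j u : scalable (transfer x j u).
Proof. exact: linearZZ. Qed.

Lemma transfer_sum x j u I (r : seq I) (G : I -> seq nat -> F^o) :
  transfer x j u (\sum_(i <- r) G i) = \sum_(i <- r) transfer x j u (G i).
Proof. exact: linear_sum. Qed.

Definition pass_weight x u b := (1 - s x * q ^+ b * (xi x * u)) / den x u.

Definition emit_weight x u b := (1 - s x ^+ 2 * q ^+ b) * xi x / den x u.

Lemma pass_weight0 x u : regular u -> pass_weight x u 0 = 1.
Proof.
by move=> ru; rewrite /pass_weight expr0 mulr1 mulrA divff //; apply: ru.
Qed.

Lemma opA_nil x u f : opA x u f [::] = f [::].
Proof. by []. Qed.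

Lemma opA_comp_cons x b u f :
  opA x u f \o cons b =
  pass_weight x u b *: opA x.+1 u (f \o cons b)
  + (emit_weight x u b * u) *: opB x.+1 u (f \o cons b.+1).
Proof.
apply/funext => bs; rewrite !fctE /= big_bool /= !subn0 addn1 addn0 !eqxx addrC.
by rewrite /pass_weight /emit_weight /den !mulrA [_ / _ * u]mulrAC.
Qed.

Lemma opB_comp_cons x b u f :
  opB x u f \o cons b =
  ((1 - q ^+ b) / den x u) *: opA x.+1 u (f \o cons b.-1)
  + ((xi x * u - s x * q ^+ b) / den x u) *: opB x.+1 u (f \o cons b).
Proof.
apply/funext => bs; rewrite !fctE /= big_bool /= addn0 addnK subn1 addrC /den.
case: b => [|b]; rewrite ?eqxx /= ?mulrA //.
by rewrite expr0 subrr !mul0r scale0r.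
Qed.

Lemma eq_transfer_cons x j u f g b bs :
  (forall k cs, f (k :: cs) = g (k :: cs)) ->
  transfer x j u f (b :: bs) = transfer x j u g (b :: bs).
Proof.
move=> eq_fg; apply: eq_bigr => j' _; congr (_ * transfer _ _ _ _ _).
by apply/funext => cs; apply: eq_fg.
Qed.

Arguments transfer : simpl never.

(* The final [field] is the Yang-Baxter equation in the first column. *)
Lemma transfer_exchange x u v f bs : u != v -> regular u -> regular v ->
  [/\ opA x u (opA x v f) bs = opA x v (opA x u f) bs,
      opB x u (opB x v f) bs = opB x v (opB x u f) bs
    & opA x u (opB x v f) bs =
        cross_factor v u * opB x v (opA x u f) bs
        + (1 - cross_factor v u) * opB x u (opA x v f) bs].
Proof.
elim: bs => [|b bs IH] in x f u v *.
  by split; rewrite /transfer //= !mulr0 addr0.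
move=> neq_uv ru rv; have neq_vu : v != u by rewrite eq_sym.
have A_comm g := let: And3 E _ _ := IH x.+1 g u v neq_uv ru rv in E.
have B_comm g := let: And3 _ E _ := IH x.+1 g u v neq_uv ru rv in E.
have AB_uv g := let: And3 _ _ E := IH x.+1 g u v neq_uv ru rv in E.
have AB_vu g := let: And3 _ _ E := IH x.+1 g v u neq_vu rv ru in E.
have [[uv vu] [du dv]] := (neq_subr neq_uv, (ru x, rv x)).
rewrite -![transfer x _ _ _ (b :: bs)]/((_ \o cons b) bs).
rewrite !(opA_comp_cons, opB_comp_cons) !transferD !transferZ.
rewrite !fctE /GRing.scale /= !(A_comm, B_comm, AB_uv, AB_vu).
rewrite /cross_factor /pass_weight /emit_weight /den in du dv *.
by case: b => [|b] /=; rewrite ?exprS ?expr0; split; field; rewrite du dv uv vu.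
Qed.

Lemma opA_comm x u v f : u != v -> regular u -> regular v ->
  opA x u (opA x v f) = opA x v (opA x u f).
Proof.
move=> neq_uv ru rv; apply/funext => bs.
by have [-> _ _] := transfer_exchange x f bs neq_uv ru rv.
Qed.

Lemma opB_comm x u v f : u != v -> regular u -> regular v ->
  opB x u (opB x v f) = opB x v (opB x u f).
Proof.
move=> neq_uv ru rv; apply/funext => bs.
by have [_ -> _] := transfer_exchange x f bs neq_uv ru rv.
Qed.

Lemma opA_opB x u v f : u != v -> regular u -> regular v ->
  opA x u (opB x v f) =
  cross_factor v u *: opB x v (opA x u f)
  + (1 - cross_factor v u) *: opB x u (opA x v f).
Proof.
move=> neq_uv ru rv; apply/funext => bs.
by have [_ _ ->] := transfer_exchange x f bs neq_uv ru rv.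
Qed.

Lemma opB_add_arrow x v f b bs : den x v != 0 ->
  opB x v f (b.+1 :: bs) =
  (q - s x * xi x * v) / den x v * opB x v (f \o incr_nth^~ 0%N) (b :: bs)
  + (1 - q) / den x v * opA x v f (b :: bs).
Proof.
move=> dv; rewrite -![transfer x _ _ _ (_ :: bs)]/((_ \o cons _) bs).
rewrite !(opA_comp_cons, opB_comp_cons) !fctE /GRing.scale /=.
rewrite /pass_weight /emit_weight /den in dv *.
by case: b => [|b] /=; rewrite ?exprS ?expr0; field.
Qed.

(** * Operators B applied to the vacuum *)

Definition admissible us := uniq us /\ {in us, forall u, regular u}.

Lemma perm_admissible us vs : perm_eq us vs -> admissible vs -> admissible us.
Proof.
move=> perm_us [uniq_vs reg_vs]; split; first by rewrite (perm_uniq perm_us).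
by move=> u; rewrite (perm_mem perm_us); apply: reg_vs.
Qed.

Lemma admissible_cons v us : admissible (v :: us) -> regular v /\ admissible us.
Proof.
case=> /= /andP[_ uniq_us] reg; split; first exact: reg (mem_head _ _).
by split=> // u us_u; apply: reg; rewrite inE us_u orbT.
Qed.

Lemma admissible_cons2 v w us : admissible [:: v, w & us] ->
  [/\ v != w, regular v, admissible (v :: us) & admissible (w :: us)].
Proof.
move=> adm; have [rv adm_w] := admissible_cons adm.
have perm_vw : perm_eq [:: w, v & us] [:: v, w & us].
  by rewrite -(cat1s w) -(cat1s v) perm_catCA.
have [_ adm_v] := admissible_cons (perm_admissible perm_vw adm).
split=> //; case: adm => /= /andP[+ _] _.
by rewrite inE negb_or => /andP[].
Qed.

Lemma admissible_pick us z : z \in picks us -> admissible us ->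
  admissible (z.1 :: z.2).
Proof. by move/perm_picks/perm_admissible. Qed.

Lemma admissible_cons_pick v us z : z \in picks us -> admissible (v :: us) ->
  v != z.1 /\ regular z.1.
Proof.
move=> /perm_picks perm_z adm.
have /admissible_cons2[neq_vz _ _ /admissible_cons[rz _]] :
    admissible [:: v, z.1 & z.2].
  by apply: perm_admissible adm; rewrite perm_cons.
by [].
Qed.

Definition cross_with us v := \prod_(w <- us) cross_factor w v.

Lemma cross_with_cons w us v :
  cross_with (w :: us) v = cross_factor w v * cross_with us v.
Proof. exact: big_cons. Qed.

Definition vacuum bs : F^o := (all (pred1 0%N) bs)%:R.

Lemma vacuumE bs : vacuum bs = (bs == nseq (size bs) 0%N)%:R.
Proof. by rewrite /vacuum (sameP (all_pred1P _ _) eqP). Qed.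

Lemma vacuum_comp_cons b : vacuum \o cons b = if b == 0%N then vacuum else 0.
Proof. by apply/funext => bs; case: b. Qed.

Lemma opA_vacuum x u : regular u -> opA x u vacuum = vacuum.
Proof.
move=> ru; apply/funext => bs; elim: bs x => // b bs IH x.
rewrite -[LHS]/((_ \o cons b) bs) opA_comp_cons !vacuum_comp_cons /=.
rewrite linear0 scaler0 addr0; case: b => [|b]; last by rewrite linear0 scaler0.
by rewrite pass_weight0 // scale1r; apply: IH.
Qed.

Definition Bstate x us := foldr (opB x) vacuum us.

Lemma opA_Bstate x v us : admissible (v :: us) ->
  opA x v (Bstate x us) = cross_with us v *: Bstate x us
    + \sum_(z <- picks us)
        ((1 - cross_factor z.1 v) * cross_with z.2 z.1) *: Bstate x (v :: z.2).
Proof.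
elim: us v => [|w us IH] v.
  move=> /admissible_cons[rv _].
  by rewrite /cross_with !big_nil scale1r addr0 opA_vacuum.
move=> /admissible_cons2[neq_vw rv adm_v adm_w].
have [rw _] := admissible_cons adm_w.
rewrite /= opA_opB // !IH // !transferD !transferZ !transfer_sum.
rewrite big_cons big_map cross_with_cons !scalerDr !scalerA /=.
rewrite addrACA -addrA !scaler_sumr -big_split /=; do 2!congr (_ + _).
apply: eq_big_seq => z us_z.
have [neq_vz _] := admissible_cons_pick us_z adm_v.
have [neq_wz _] := admissible_cons_pick us_z adm_w.
rewrite !transferZ (opB_comm _ _ neq_vw rv rw) !scalerA -scalerDl.
rewrite cross_with_cons /cross_factor; congr (_ *: _).
have [[_ wv] [_ zv] [wz zw]] :=
  And3 (neq_subr neq_vw) (neq_subr neq_vz) (neq_subr neq_wz).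
by field; rewrite wv zv wz zw.
Qed.

Lemma Bstate_succ x us b bs : admissible us ->
  Bstate x us (b.+1 :: bs) =
  \sum_(z <- picks us)
     (1 - q) / den x z.1 * cross_with z.2 z.1 * Bstate x z.2 (b :: bs).
Proof.
elim: us b bs => [|v us IH] b bs adm_v; first by rewrite big_nil.
have [rv adm_us] := admissible_cons adm_v.
pose g := \sum_(z <- picks us)
  ((1 - q) / den x z.1 * cross_with z.2 z.1) *: Bstate x z.2.
have add_arrow k cs : (Bstate x us \o incr_nth^~ 0%N) (k :: cs) = g (k :: cs).
  by rewrite /g fct_sumE; apply: IH.
rewrite [LHS]opB_add_arrow // opA_Bstate //.
rewrite (eq_transfer_cons _ _ _ _ _ add_arrow).
rewrite /g transfer_sum big_cons big_map !fctE !fct_sumE /GRing.scale /=.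
rewrite mulrDr mulrA addrCA !mulr_sumr -big_split /=; congr (_ + _).
apply: eq_big_seq => z us_z.
have [neq_vz rz] := admissible_cons_pick us_z adm_v.
rewrite transferZ !fctE /GRing.scale /= cross_with_cons /cross_factor.
have [[vz zv] [dv dz]] := (neq_subr neq_vz, (rv x, rz x)).
by rewrite /den in dv dz *; field; rewrite vz zv dv dz.
Qed.

Lemma Bstate_comp_cons0 x us :
  Bstate x us \o cons 0%N =
  (\prod_(u <- us) ((xi x * u - s x) / den x u)) *: Bstate x.+1 us.
Proof.
elim: us => [|v us IH]; first by rewrite big_nil scale1r vacuum_comp_cons.
rewrite opB_comp_cons expr0 subrr mul0r scale0r add0r mulr1 IH.
by rewrite transferZ scalerA big_cons.
Qed.

(* The symmetrization of a product, by recursion on the choice of the variable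
   put at the last position; [hs] lists the factors from the last one on. *)
Fixpoint symprod (hs : seq (F -> F)) us : F :=
  if hs is h :: hs' then
    \sum_(z <- picks us) h z.1 * cross_with z.2 z.1 * symprod hs' z.2
  else (us == [::])%:R.

Lemma symprod_scale (r : F -> F) hs us :
  (\prod_(u <- us) r u) * symprod hs us = symprod [seq r \* h | h <- hs] us.
Proof.
elim: hs us => [|h hs IH] us /=.
  by case: us => [|u us]; rewrite ?big_nil ?mul1r ?mulr0.
rewrite mulr_sumr; apply: eq_big_seq => z us_z.
by rewrite -(perm_big _ (perm_picks us_z)) big_cons -IH /=; ring.
Qed.

Definition phi_from x k u :=
  (1 - q) / den k u * \prod_(x <= y < k) ((xi y * u - s y) / den y u).

Fixpoint positions x bs : seq nat :=
  if bs is b :: bs' then nseq b x ++ positions x.+1 bs' else [::].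

Lemma positions_ge x bs k : k \in positions x bs -> (x <= k)%N.
Proof.
elim: bs x => //= b bs IH x.
by rewrite mem_cat mem_nseq => /orP[/andP[_ /eqP->]//|/IH/ltnW].
Qed.

Lemma Bstate_symprod x bs us : admissible us ->
  Bstate x us bs = symprod [seq phi_from x k | k <- positions x bs] us.
Proof.
elim: bs x us => [|b bs IH] x us adm; first by case: us adm.
elim: b us adm => [|b IHb] us adm.
  rewrite -[LHS]/((_ \o cons _) bs) Bstate_comp_cons0 fctE IH //.
  rewrite [LHS]symprod_scale -map_comp; congr symprod.
  apply/eq_in_map => k k_bs; apply/funext => u.
  by rewrite /= /phi_from (big_ltn (positions_ge k_bs)) mulrCA.
rewrite Bstate_succ //; apply: eq_big_seq => z us_z.
have [_ adm_z] := admissible_cons (admissible_pick us_z adm).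
by rewrite IHb // /phi_from big_geq // mulr1.
Qed.

(** * Operators A applied to arrows in the leftmost column *)

Definition stacked n bs : F^o :=
  if bs is b :: bs' then (b == n)%:R * vacuum bs' else 0.

Lemma stacked_comp_cons n k : stacked n \o cons k = (k == n)%:R *: vacuum.
Proof. by apply/funext. Qed.

Definition Astate x n vs := foldr (opA x) (stacked n) vs.

(* [counts * f], [count_opA x v] and [mixed_opA x w v] are the operators
   q^(arrows in the leftmost column), A'(v) and M(w, v) of the header; their
   values on [::] are those of an empty leftmost column. *)
Definition counts bs : F^o := q ^+ head 0%N bs.

Definition passes x u bs : F^o := pass_weight x u (head 0%N bs).

Definition count_opA x v f bs : F^o :=
  if bs is k :: bs' then q ^+ k * opA x.+1 v (f \o cons k) bs' else f [::].

Definition mixed_opA x w v f bs : F^o :=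
  if bs is k :: bs' then
    pass_weight x w k * opA x.+1 v (f \o cons k) bs'
    + emit_weight x w k * v * opB x.+1 v (f \o cons k.+1) bs'
  else f [::].

Lemma passes_nil x u : regular u -> passes x u [::] = 1.
Proof. by move=> ru; rewrite /passes pass_weight0. Qed.

Lemma eq_comp_cons f g :
  f [::] = g [::] -> (forall k, f \o cons k = g \o cons k) -> f = g.
Proof.
move=> eq_nil eq_cons; apply/funext; case=> // k bs.
by rewrite -[LHS]/((f \o cons k) bs) eq_cons.
Qed.

Lemma addf_comp f g (h : seq nat -> seq nat) :
  (f + g) \o h = (f \o h) + (g \o h).
Proof. by []. Qed.

Lemma scalef_comp a f (h : seq nat -> seq nat) : (a *: f) \o h = a *: (f \o h).
Proof. by []. Qed.

Lemma scalef_mulr a f g : a *: (f * g) = f * (a *: g).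
Proof. by apply/funext => bs; apply: mulrCA. Qed.

Lemma counts_comp_cons f k : (counts * f) \o cons k = q ^+ k *: (f \o cons k).
Proof. by apply/funext. Qed.

Lemma passes_comp_cons x u f k :
  (passes x u * f) \o cons k = pass_weight x u k *: (f \o cons k).
Proof. by apply/funext. Qed.

Lemma count_opA_comp_cons x v f k :
  count_opA x v f \o cons k = q ^+ k *: opA x.+1 v (f \o cons k).
Proof. by apply/funext. Qed.

Lemma mixed_opA_comp_cons x w v f k :
  mixed_opA x w v f \o cons k =
  pass_weight x w k *: opA x.+1 v (f \o cons k)
  + (emit_weight x w k * v) *: opB x.+1 v (f \o cons k.+1).
Proof. by apply/funext. Qed.

Definition comp_consE := (addf_comp, scalef_comp, counts_comp_cons,
  passes_comp_cons, count_opA_comp_cons, mixed_opA_comp_cons, opA_comp_cons).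

Lemma mixed_opA_linear x w v : linear (mixed_opA x w v).
Proof.
move=> a f g; apply: eq_comp_cons => // k.
rewrite !comp_consE !transferD !transferZ; apply/funext => bs.
by rewrite !fctE /GRing.scale /=; ring.
Qed.

HB.instance Definition _ x w v :=
  GRing.isLinear.Build F (seq nat -> F^o) (seq nat -> F^o) _ _
    (mixed_opA_linear x w v).

Lemma mixed_opAD x w v : {morph mixed_opA x w v : f g / f + g}.
Proof. exact: linearD. Qed.

Lemma mixed_opAZ x w v : scalable (mixed_opA x w v).
Proof. exact: linearZZ. Qed.

Lemma mixed_opA_sum x w v I (r : seq I) (G : I -> seq nat -> F^o) :
  mixed_opA x w v (\sum_(i <- r) G i) = \sum_(i <- r) mixed_opA x w v (G i).
Proof. exact: linear_sum. Qed.

Lemma count_opA_opA x v w f : v != w -> regular v -> regular w ->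
  q *: count_opA x v (opA x w f) =
  cross_factor w v *: opA x w (count_opA x v f)
  + (q - cross_factor w v) *: mixed_opA x w v (count_opA x w f).
Proof.
move=> neq_vw rv rw; have [_ wv] := neq_subr neq_vw.
apply: eq_comp_cons => [|k].
  by rewrite !fctE /= -scalerDl addrC subrK.
do ![rewrite !comp_consE | rewrite !transferD | rewrite !transferZ].
rewrite opA_comm // opA_opB //; apply/funext => bs.
by rewrite !fctE /GRing.scale /= /cross_factor exprS; field.
Qed.

Lemma mixed_opA_opA x p v w f : v != w -> p != w ->
  regular v -> regular w -> regular p ->
  cross_factor w p *: mixed_opA x p v (opA x w f) =
  cross_factor w v *: opA x w (mixed_opA x p v f)
  + (cross_factor w p - cross_factor w v)
    *: mixed_opA x w v (mixed_opA x p w f).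
Proof.
move=> neq_vw neq_pw rv rw rp; have neq_wv : w != v by rewrite eq_sym.
have [[vw wv] [_ wp]] := (neq_subr neq_vw, neq_subr neq_pw).
apply: eq_comp_cons => [|k].
  by rewrite !fctE /= -scalerDl addrC subrK.
do ![rewrite !comp_consE | rewrite !transferD | rewrite !transferZ].
rewrite !(opA_comm _ _ neq_vw rv rw) !(opB_comm _ _ neq_vw rv rw).
rewrite !(opA_opB _ _ neq_vw rv rw) !(opA_opB _ _ neq_wv rw rv).
apply/funext => bs; rewrite !fctE /GRing.scale /= /cross_factor.
move: (rw x) (rp x); rewrite /pass_weight /emit_weight /den !exprS => dw dp.
by field; rewrite ?vw ?wv ?wp ?dw ?dp.
Qed.

Lemma counts_opA x w f : regular w ->
  q *: (counts * opA x w f) =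
  opA x w (counts * f) + (q - 1) *: (passes x w * count_opA x w f).
Proof.
move=> rw; apply: eq_comp_cons => [|k].
  by rewrite !fctE passes_nil // !opA_nil /counts /GRing.scale /= expr0; ring.
do ![rewrite !comp_consE | rewrite !transferD | rewrite !transferZ].
by apply/funext => bs; rewrite !fctE /GRing.scale /= exprS; ring.
Qed.

Lemma passes_opA x p w f : p != w -> regular w -> regular p ->
  cross_factor w p *: (passes x p * opA x w f) =
  opA x w (passes x p * f)
  + (q - cross_factor p w) *: (passes x w * mixed_opA x p w f).
Proof.
move=> neq_pw rw rp; have [pw wp] := neq_subr neq_pw.
apply: eq_comp_cons => [|k].
  rewrite !fctE !opA_nil !passes_nil // /cross_factor /GRing.scale /=.
  by field; rewrite wp pw.
do ![rewrite !comp_consE | rewrite !transferD | rewrite !transferZ].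
apply/funext => bs; rewrite !fctE /GRing.scale /= /cross_factor.
move: (rw x) (rp x); rewrite /pass_weight /emit_weight /den !exprS => dw dp.
by field; rewrite dw dp wp pw.
Qed.

Lemma count_opA_Astate x n v vs : admissible (v :: vs) ->
  q ^+ size vs *: count_opA x v (Astate x n vs) =
  q ^+ n *: (cross_with vs v *: Astate x n vs
    + \sum_(z <- picks vs) ((q - cross_factor z.1 v) * cross_with z.2 z.1)
        *: mixed_opA x z.1 v (Astate x n z.2)).
Proof.
elim: vs v => [|w vs IH] v.
  move=> /admissible_cons[rv _].
  rewrite /cross_with !big_nil addr0 !scale1r; apply: eq_comp_cons => [|k].
    by rewrite !fctE /= scaler0.
  rewrite !comp_consE /= stacked_comp_cons transferZ opA_vacuum //.
  by have [->//|_] := eqVneq k n; rewrite !scale0r !scaler0.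
move=> /admissible_cons2[neq_vw rv adm_v adm_w].
have [rw _] := admissible_cons adm_w.
rewrite [size _]/= exprSr -scalerA count_opA_opA // scalerDr.
rewrite 2!(scaleCA (q ^+ size vs)) -transferZ -mixed_opAZ !IH //.
rewrite !(transferZ, transferD, transfer_sum).
rewrite !(mixed_opAZ, mixed_opAD, mixed_opA_sum).
rewrite 2![_ *: (q ^+ n *: _)]scaleCA -scalerDr big_cons big_map /=.
rewrite cross_with_cons; congr (_ *: _).
rewrite !scalerDr !scalerA addrACA -addrA !scaler_sumr -big_split /=.
do 2!congr (_ + _); apply: eq_big_seq => z vs_z.
have [neq_vz rz] := admissible_cons_pick vs_z adm_v.
have [neq_wz _] := admissible_cons_pick vs_z adm_w.
have neq_zw : z.1 != w by rewrite eq_sym.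
rewrite transferZ mixed_opAZ cross_with_cons [in RHS]mulrCA [in RHS]mulrC.
rewrite -[RHS]scalerA mixed_opA_opA // scalerDr !scalerA.
have [[_ wv] [_ zv] [wz zw]] :=
  And3 (neq_subr neq_vw) (neq_subr neq_vz) (neq_subr neq_wz).
rewrite /cross_factor.
by congr (_ *: _ + _ *: _); field; rewrite ?wv ?zv ?wz ?zw.
Qed.

Lemma counts_Astate x n vs : admissible vs ->
  q ^+ size vs *: (counts * Astate x n vs) =
  q ^+ n *: (Astate x n vs + \sum_(z <- picks vs)
    ((q - 1) * cross_with z.2 z.1) *: (passes x z.1 * Astate x n z.2)).
Proof.
elim: vs => [|w vs IH] adm_w.
  rewrite big_nil addr0 scale1r; apply: eq_comp_cons => [|k].
    by rewrite !fctE /= mulr0 scaler0.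
  rewrite !comp_consE stacked_comp_cons.
  by have [->//|_] := eqVneq k n; rewrite scale0r !scaler0.
have [rw adm_vs] := admissible_cons adm_w.
rewrite [size _]/= exprSr -scalerA counts_opA // scalerDr -transferZ IH //.
rewrite transferZ scaleCA (scalef_mulr _ (passes x w)) count_opA_Astate //.
rewrite -scalef_mulr scaleCA -scalerDr; congr (_ *: _).
rewrite big_cons big_map transferD transfer_sum /= mulrDr mulr_sumr.
rewrite -(scalef_mulr _ (passes x w)) scalerDr scalerA scaler_sumr.
rewrite addrACA -addrA -big_split /=; do 2!congr (_ + _).
apply: eq_big_seq => z vs_z.
have [neq_wz rz] := admissible_cons_pick vs_z adm_w.
have neq_zw : z.1 != w by rewrite eq_sym.
rewrite cross_with_cons [in RHS]mulrCA [in RHS]mulrC -[RHS]scalerA.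
rewrite passes_opA // scalerDr transferZ.
by rewrite -(scalef_mulr _ (passes x w)) !scalerA; congr (_ + _ *: _); ring.
Qed.

Lemma Astate_recursion x n vs k bs : admissible vs ->
  (q ^+ n - q ^+ (size vs + k)) * Astate x n vs (k :: bs) =
  q ^+ n * \sum_(z <- picks vs)
    (1 - q) * pass_weight x z.1 k * cross_with z.2 z.1
      * Astate x n z.2 (k :: bs).
Proof.
move=> adm_vs; have := congr1 (@^~ (k :: bs)) (counts_Astate x n adm_vs).
rewrite !fctE fct_sumE /GRing.scale /= mulrA -exprD => countsE.
rewrite mulrBl {}countsE mulrDr opprD addrA subrr add0r -mulrN -sumrN.
congr (_ * _); apply: eq_bigr => z _.
by rewrite !fctE /GRing.scale /passes /=; ring.
Qed.

Lemma Astate_eq0 x n vs k : (size vs + k < n)%N -> Astate x n vs \o cons k = 0.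
Proof.
elim: vs k => [|v vs IH] k /= few.
  by rewrite stacked_comp_cons ltn_eqF // scale0r.
by rewrite opA_comp_cons !IH ?addnS ?(ltnW few) // !linear0 addr0.
Qed.

Lemma Astate_tight x n vs k : (size vs + k = n)%N ->
  Astate x n vs \o cons k =
  ((\prod_(i < size vs) (1 - s x ^+ 2 * q ^+ (k + i)))
  * (\prod_(v <- vs) (xi x * v / den x v))) *: Bstate x.+1 vs.
Proof.
elim: vs k => [|v vs IH] k /= tight.
  by rewrite stacked_comp_cons -tight eqxx big_ord0 big_nil mulr1.
rewrite opA_comp_cons Astate_eq0; last by rewrite -tight.
rewrite linear0 scaler0 add0r IH; last by rewrite addnS.
rewrite transferZ scalerA big_ord_recl big_cons addn0.
have shift_k (i : 'I_(size vs)) : (1 - s x ^+ 2 * q ^+ (k + lift ord0 i)) =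
    1 - s x ^+ 2 * q ^+ (k.+1 + i) :> F.
  by rewrite lift0 addnS.
rewrite [in RHS](eq_bigr _ (fun i _ => shift_k i)).
by congr (_ *: _); rewrite /emit_weight; ring.
Qed.

(* [qpoch q q m] gathers the factors 1 - q^i by which [Astate_recursion] has to
   be divided. *)
Lemma Astate_symprod x n m vs k bs : admissible vs -> q != 0 ->
  (size vs + k = n + m)%N -> (k <= n)%N ->
  qpoch q q m * Astate x n vs (k :: bs) =
  (\prod_(i < n - k) (1 - s x ^+ 2 * q ^+ (k + i))) *
  symprod (nseq m (fun v => (1 - q) * pass_weight x v k)
           ++ [seq (fun v => xi x * v / den x v * phi_from x.+1 y v)
                  | y <- positions x.+1 bs]) vs.
Proof.
move=> + q_neq0 + le_kn.
elim: m vs => [|m IH] vs adm_vs size_vs.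
  rewrite /qpoch big_ord0 mul1r -[Astate _ _ _ _]/((_ \o cons k) bs).
  rewrite Astate_tight ?size_vs ?addn0 // fctE /GRing.scale /=.
  have -> : size vs = (n - k)%N by rewrite -(addn0 n) -size_vs addnK.
  by rewrite Bstate_symprod // -mulrA symprod_scale -map_comp.
apply: (mulfI (expf_neq0 n q_neq0)).
transitivity
  (qpoch q q m * ((q ^+ n - q ^+ (size vs + k)) * Astate x n vs (k :: bs))).
  by rewrite /qpoch big_ord_recr -exprS size_vs exprD /=; ring.
rewrite Astate_recursion // mulrCA; congr (_ * _); rewrite !mulr_sumr.
apply: eq_big_seq => z vs_z.
have [_ adm_z] := admissible_cons (admissible_pick vs_z adm_vs).
have size_z : (size z.2 + k = n + m)%N.
  apply: succn_inj; rewrite -addSn -addnS -size_vs.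
  by rewrite -(perm_size (perm_picks vs_z)).
by rewrite mulrCA IH // mulrCA.
Qed.

End TransferOperators.

(** * Symmetrization over the symmetric group *)

Section Symmetrization.
Context {F : fieldType} (q : F).

Lemma widen_ord_lift n (i : 'I_n) : widen_ord (leqnSn n) i = lift ord_max i.
Proof. by apply: val_inj; rewrite [RHS]lift_max. Qed.

Lemma cross_ordS n (w : 'I_n.+1 -> F) :
  cross q w = cross q (w \o lift ord_max)
    * \prod_(i < n) cross_factor q (w (lift ord_max i)) (w ord_max).
Proof.
rewrite /cross big_ord_recr /= [X in _ * X]big1 ?mulr1; last first.
  by move=> i; rewrite ltnNge -ltnS ltn_ord.
rewrite -big_split; apply: eq_bigr => i _ /=.
rewrite big_mkcond big_ord_recr /= ltn_ord widen_ord_lift; congr (_ * _).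
by rewrite -big_mkcond /=; apply: eq_big => j // _; rewrite widen_ord_lift.
Qed.

Lemma cross_with_codom n (u : 'I_n -> F) v :
  cross_with q (codom u) v = \prod_(i < n) cross_factor q (u i) v.
Proof. by rewrite /cross_with codomE big_map big_enum. Qed.

Lemma symmetrize_perm n (f : ('I_n -> F) -> F) (u : 'I_n -> F) (p : 'S_n) :
  symmetrize f (u \o p) = symmetrize f u.
Proof.
rewrite /symmetrize [RHS](reindex_inj (mulIg p)); apply: eq_bigr => p' _.
by congr f; apply/funext => i; rewrite /= permM.
Qed.

Lemma symmetrize_rev n (f : ('I_n -> F) -> F) (u : 'I_n -> F) :
  symmetrize f (u \o @rev_ord n) = symmetrize f u.
Proof.
rewrite -(symmetrize_perm f u (perm (@rev_ord_inj n))).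
by congr symmetrize; apply/funext => i; rewrite /= permE.
Qed.

Lemma symmetrize_symprod n (h : nat -> F -> F) (u : 'I_n -> F) :
  symmetrize (fun w => cross q w * \prod_(i < n) h i (w i)) u =
  symprod q (rev (mkseq h n)) (codom u).
Proof.
elim: n u => [|n IH] u.
  rewrite /symmetrize (big_pred1 1%g) => [|p /=].
    by rewrite /cross !big_ord0 mulr1 codomE enum_ord0.
  by symmetry; apply/eqP/permP => -[].
rewrite mkseqS rev_rcons /= picks_codom big_map big_enum /symmetrize.
rewrite (big_lift_perm _ ord_max); apply: eq_bigr => j _ /=.
rewrite -IH /symmetrize mulr_sumr; apply: eq_bigr => p _.
rewrite cross_ordS big_ord_recr /= lift_perm_id cross_with_codom.
have perm_lift i :
    u (lift_perm ord_max j p (lift ord_max i)) = (u \o lift j) (p i).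
  by rewrite lift_perm_lift.
under eq_bigr do rewrite perm_lift.
under [X in _ * (X * _)]eq_bigr do rewrite widen_ord_lift perm_lift.
have -> : (fun i => u (lift_perm ord_max j p i)) \o lift ord_max =
    u \o lift j \o p.
  by apply/funext => i; apply: perm_lift.
by rewrite [in RHS](reindex_inj (@perm_inj _ p)) /=; ring.
Qed.

End Symmetrization.

(** * Expansion of the transfer operators over rows of edges *)

Section RowSums.
Context {F : fieldType} (q : F) (xi s : nat -> F).
Implicit Types (x b n L : nat) (u : F) (us : seq F) (bs : seq nat) (j : bool)
  (h : seq bool) (H : seq (seq bool)) (f : seq nat -> F^o).

(* The occupation numbers below a row with horizontal edges [j :: h] and
   occupation numbers [bs] above it. *)
Definition below j h bs : seq nat :=
  mkseq (fun x => nth 0%N bs x + nth false h x - nth false (j :: h) x)%N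
    (size bs).

Definition row_weight x u j h bs : F :=
  \prod_(i < size bs) vertex_weight q (xi (x + i)%N * u) (s (x + i)%N)
    (nth 0%N (below j h bs) i) (nth false (j :: h) i)
    (nth 0%N bs i) (nth false h i)
  * (~~ last j h)%:R.

Lemma below_cons j j' h b bs :
  below j (j' :: h) (b :: bs) = (b + j' - j)%N :: below j' h bs.
Proof. exact: mkseq_cons. Qed.

Lemma row_weight_cons x u j j' h b bs :
  row_weight x u j (j' :: h) (b :: bs) =
  vertex_weight q (xi x * u) (s x) (b + j' - j) j b j'
    * row_weight x.+1 u j' h bs.
Proof.
rewrite /row_weight below_cons big_ord_recl /= addn0 -mulrA.
by congr (_ * (_ * _)); apply: eq_bigr => i _; rewrite addSnnS.
Qed.

Lemma transferE L x j u f bs : size bs = L ->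
  transfer q xi s x j u f bs =
  \sum_(h : L.-tuple bool) row_weight x u j h bs * f (below j h bs).
Proof.
elim: bs L x j f => [|b bs IH] [|L] x j f //= => [_|[size_bs]].
  rewrite big_tuple0 /row_weight big_ord0 mul1r.
  by case: j; rewrite ?mul0r ?mul1r.
rewrite big_tuple_cons; apply: eq_bigr => j' _.
rewrite (IH _ _ _ _ size_bs) mulr_sumr; apply: eq_bigr => h _.
by rewrite row_weight_cons below_cons mulrA.
Qed.

(* The rows of [H] and the spectral parameters [us] are listed from top to
   bottom. *)
Definition below_rows j H bs := foldl (fun cs h => below j h cs) bs H.

Definition rows_weight us j H bs : F :=
  \prod_(i < size H)
    row_weight 0 (nth 0 us i) j (nth [::] H i) (below_rows j (take i H) bs).

Lemma size_below_rows j H bs : size (below_rows j H bs) = size bs.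
Proof. by elim: H bs => //= h H IH bs; rewrite IH size_mkseq. Qed.

Lemma below_rows_take j H bs i : (i < size H)%N ->
  below_rows j (take i.+1 H) bs =
  below j (nth [::] H i) (below_rows j (take i H) bs).
Proof.
by move=> lt_iH; rewrite (take_nth [::] lt_iH) /below_rows foldl_rcons.
Qed.

Lemma foldr_transferE L n j us f bs : size bs = L -> size us = n ->
  foldr (transfer q xi s 0 j) f us bs =
  \sum_(H : n.-tuple (L.-tuple bool))
    rows_weight us j (map val H) bs * f (below_rows j (map val H) bs).
Proof.
elim: us n bs => [|u us IH] [|n] bs //= size_bs => [_|[size_us]].
  by rewrite big_tuple0 /rows_weight big_ord0 mul1r.
rewrite (transferE _ _ _ _ size_bs) big_tuple_cons; apply: eq_bigr => h _.
rewrite (IH n) ?size_mkseq // mulr_sumr; apply: eq_bigr => H _.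
by rewrite mulrA /rows_weight /= big_ord_recl.
Qed.

Lemma vertex_weight_empty x u : den xi s x u != 0 ->
  vertex_weight q (xi x * u) (s x) 0 false 0 false = 1.
Proof. by rewrite /den /= expr0 mulr1 mulrA => /divff. Qed.

Lemma vertex_weight_neq0 u t a j b j' :
  vertex_weight q u t a j b j' != 0 -> (a + j = b + j')%N.
Proof.
case: j j' => [] [] /=; case: ifP => [/eqP->|]; rewrite ?eqxx //;
by rewrite ?addn0 ?addn1.
Qed.

Lemma prod_vertex_weight_trunc L u (a b : nat -> nat) (h : nat -> bool) :
  regular xi s u ->
  (forall x, (L <= x)%N -> [/\ a x = 0%N, b x = 0%N & h x = false]) ->
  \big[*%R/1]_(x \in [set: nat]%classic)
    vertex_weight q (xi x * u) (s x) (a x) (h x) (b x) (h x.+1) =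
  \prod_(x < L) vertex_weight q (xi x * u) (s x) (a x) (h x) (b x) (h x.+1).
Proof.
move=> ru empty.
rewrite (fsbig_ord _ _ (fun x =>
  vertex_weight q (xi x * u) (s x) (a x) (h x) (b x) (h x.+1))).
symmetry; apply: fsbig_widen => // x [_ /= /negP]; rewrite -leqNgt => le_Lx.
have [-> -> ->] := empty x le_Lx; have [_ _ ->] := empty x.+1 (leqW le_Lx).
exact: vertex_weight_empty.
Qed.

End RowSums.

(** * Arrow configurations *)

Section Configurations.
Context {F : fieldType} (q : F) (xi s : nat -> F) (n : nat).
Implicit Types (y : 'I_n) (x d : nat) (c : config n).

Lemma ind_from_top (P : nat -> Prop) :
  P n -> (forall y : 'I_n, P y.+1 -> P y) -> forall d, (d <= n)%N -> P d.
Proof.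
move=> Pn Pstep d le_dn; rewrite -(subKn le_dn).
elim: (n - d)%N (leq_subr d n) => [|e IH] lt_en; first by rewrite subn0.
have lt_n : (n - e.+1 < n)%N by rewrite ltn_subrL (leq_ltn_trans _ lt_en).
by apply: (Pstep (Ordinal lt_n)); rewrite /= subnSK //; apply/IH/ltnW.
Qed.

Section Decoding.
Context (L : nat) (j : bool) (bs : seq nat) (size_bs : size bs = L).
Implicit Types H : n.-tuple (L.-tuple bool).

Definition config_of H : config n :=
  (fun (d : 'I_n.+1) x =>
     nth 0%N (below_rows j (take (n - d) (map val H)) bs) x,
   fun (y : 'I_n) x => nth false (j :: nth [::] (map val H) (rev_ord y)) x).

Lemma size_rows H : size (map val H) = n.
Proof. by rewrite size_map size_tuple. Qed.

Lemma nth_rows H y : nth [::] (map val H) y = tnth H y.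
Proof. by rewrite -tnth_nth tnth_map. Qed.

Lemma config_of_edge H y x :
  (config_of H).2 y x = nth false (j :: tnth H (rev_ord y)) x.
Proof. by rewrite -nth_rows. Qed.

Lemma config_of_occupation H d x : (d <= n)%N ->
  (config_of H).1 (inord d) x =
  nth 0%N (below_rows j (take (n - d) (map val H)) bs) x.
Proof. by move=> le_dn; rewrite /= inordK. Qed.

Lemma config_of_inj : injective config_of.
Proof.
move=> H H' eq_c; apply: eq_from_tnth => y; apply: eq_from_tnth => x.
have := congr1 (fun c : config n => c.2 (rev_ord y) x.+1) eq_c.
by rewrite !config_of_edge rev_ordK /= -!tnth_nth.
Qed.

Lemma config_of_row_weight u y H : regular xi s u ->
  \big[*%R/1]_(x \in [set: nat]%classic)
    vertex_weight q (xi x * u) (s x)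
      ((config_of H).1 (inord y) x) ((config_of H).2 y x)
      ((config_of H).1 (inord y.+1) x) ((config_of H).2 y x.+1) =
  row_weight q xi s 0 u j (tnth H (rev_ord y))
    (below_rows j (take (rev_ord y) (map val H)) bs).
Proof.
move=> ru; set h := tnth H _; set cs := below_rows _ _ _.
have size_cs : size cs = L by rewrite size_below_rows.
have lt_row : (rev_ord y < size (map val H))%N by rewrite size_rows.
have -> : (config_of H).1 (inord y.+1) = nth 0%N cs.
  by apply/funext => x; rewrite config_of_occupation.
have -> : (config_of H).1 (inord y) = nth 0%N (below j h cs).
  apply/funext => x; rewrite config_of_occupation 1?ltnW //.
  by rewrite -(subnSK (ltn_ord y)) below_rows_take // (nth_rows H (rev_ord y)).
have -> : (config_of H).2 y = nth false (j :: h).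
  by apply/funext => x; rewrite config_of_edge.
rewrite (prod_vertex_weight_trunc (L := L.+1) q) //; last first.
  move=> x lt_Lx.
  by rewrite !nth_default //= ?size_mkseq ?size_cs ?size_tuple // ltnW.
rewrite big_ord_recr /row_weight size_cs; congr (_ * _).
rewrite -[nat_of_ord ord_max]/L.
have -> : nth false (j :: h) L = last j h.
  by rewrite (last_nth false) size_tuple.
rewrite !nth_default //= ?size_mkseq ?size_cs ?size_tuple //.
by case: (last j h) => //=; apply: vertex_weight_empty.
Qed.

Lemma config_of_weight (u : 'I_n -> F) H : (forall y, regular xi s (u y)) ->
  config_weight q xi s u (config_of H) =
  rows_weight q xi s (codom (u \o @rev_ord n)) j (map val H) bs.
Proof.
move=> ru; rewrite /config_weight /rows_weight size_rows.
rewrite (reindex_inj rev_ord_inj); apply: eq_bigr => i _.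
rewrite config_of_row_weight // rev_ordK nth_rows; congr row_weight.
by rewrite codomE (nth_map i) ?size_enum_ord // nth_ord_enum.
Qed.

End Decoding.

Definition occupation (L N : nat) (la : signature N) : seq nat :=
  mkseq (fun x => mult x la) L.

Lemma size_occupation (L N : nat) (la : signature N) :
  size (occupation L la) = L.
Proof. exact: size_mkseq. Qed.

Lemma nth_occupation (L N : nat) (la : signature N) x :
  (forall x, (L <= x)%N -> mult x la = 0%N) ->
  nth 0%N (occupation L la) x = mult x la.
Proof.
move=> la_lt; case: (ltnP x L) => [lt_xL|le_Lx]; first by rewrite nth_mkseq.
by rewrite nth_default ?size_occupation ?la_lt.
Qed.

Section Boundary.
Context (K M L : nat) (la : signature K) (mu : signature M) (j : bool).
Context (la_lt : forall x, (L <= x)%N -> mult x la = 0%N).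
Context (mu_lt : forall x, (L <= x)%N -> mult x mu = 0%N).
Let bs := occupation L mu.
Implicit Types (H : n.-tuple (L.-tuple bool)).

Lemma config_of_configs H : below_rows j (map val H) bs = occupation L la ->
  configs la mu j (config_of j bs H).
Proof.
move=> below_la; split=> [|| x | x | //].
- pose box := ([set: 'I_n.+1] `*` `I_L)%classic.
  apply: (@sub_finite_set _ _ box) => [[d x] /= a_neq0|]; last first.
    exact: finite_setX.
  split=> //=; rewrite ltnNge; apply/negP => le_Lx; apply: a_neq0.
  by rewrite nth_default // size_below_rows size_occupation.
- pose box := ([set: 'I_n] `*` `I_L.+1)%classic.
  apply: (@sub_finite_set _ _ box) => [[y x] edge|]; last exact: finite_setX.
  split=> //=; rewrite ltnNge; apply/negP => lt_Lx.
  have : (config_of j bs H).2 y x := edge.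
  by rewrite config_of_edge nth_default //= size_tuple.
- by rewrite /= subn0 take_oversize ?size_rows // below_la nth_occupation.
- by rewrite /= subnn take0 nth_occupation.
Qed.

Lemma configs_bounded c : configs la mu j c ->
  exists X, forall x, (X <= x)%N ->
    (forall d : 'I_n.+1, c.1 d x = 0%N) /\ (forall y, c.2 y x = false).
Proof.
case=> finite_a finite_h _ _ _.
have bounded (T : choiceType) (A : set (T * nat)) : finite_set A ->
    exists X, forall z, A z -> (z.2 < X)%N.
  move=> /finite_seqP[r ->]; exists (\max_(z <- r) z.2).+1 => z /= r_z.
  by rewrite ltnS; apply: leq_bigmax_seq.
have [[X a_lt] [X' h_lt]] := (bounded _ _ finite_a, bounded _ _ finite_h).
exists (maxn X X') => x; rewrite geq_max => /andP[le_Xx le_X'x].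
split=> [d|y].
  by apply: contrapT => /(a_lt (d, x)); rewrite /= ltnNge le_Xx.
by apply/negP => /(h_lt (y, x)); rewrite /= ltnNge le_X'x.
Qed.

Lemma configs_conservation (u : 'I_n -> F) c (y : 'I_n) x :
  (forall y, regular xi s (u y)) -> configs la mu j c ->
  config_weight q xi s u c != 0 ->
  (c.1 (inord y) x + c.2 y x = c.1 (inord y.+1) x + c.2 y x.+1)%N.
Proof.
move=> ru /configs_bounded[X empty]; rewrite /config_weight (bigD1 y) //=.
rewrite mulf_eq0 negb_or => /andP[+ _].
rewrite (prod_vertex_weight_trunc (L := X) q) //; last first.
  by move=> z /empty[no_arrow no_edge]; rewrite !no_arrow no_edge.
case: (ltnP x X) => [lt_xX|le_Xx].
  rewrite (bigD1 (Ordinal lt_xX)) //= mulf_eq0 negb_or => /andP[+ _].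
  exact: vertex_weight_neq0.
have [no_arrow no_edge] := empty x le_Xx.
have [_ no_next_edge] := empty x.+1 (leqW le_Xx).
by rewrite !no_arrow no_edge no_next_edge.
Qed.

Section Encoding.
Context (c : config n) (c_configs : configs la mu j c).
Context (conserved : forall (y : 'I_n) x,
  (c.1 (inord y) x + c.2 y x = c.1 (inord y.+1) x + c.2 y x.+1)%N).

Lemma configs_top x : c.1 (inord n) x = mult x mu.
Proof.
have [_ _ _ top _] := c_configs.
by rewrite -top; congr c.1; apply: val_inj; rewrite /= inordK.
Qed.

Lemma configs_bottom x : c.1 (inord 0) x = mult x la.
Proof.
have [_ _ bottom _ _] := c_configs.
by rewrite -bottom; congr c.1; apply: val_inj; rewrite /= inordK.
Qed.

(* An edge entering a column [x >= L] cannot turn up, hence it would continue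
   to the right forever. *)
Lemma row_supported (y : 'I_n) :
  (forall x, (L <= x)%N -> c.1 (inord y.+1) x = 0%N) ->
  forall x, (L <= x)%N -> c.1 (inord y) x = 0%N /\ c.2 y x = false.
Proof.
have [X empty] := configs_bounded c_configs.
move=> above x le_Lx.
have no_edge_upto d z : (L <= z)%N -> (X <= z + d)%N -> c.2 y z = false.
  elim: d z => [|d IH] z le_Lz; first by rewrite addn0 => /empty[_ ->].
  rewrite -addSnnS => /(IH _ (leqW le_Lz)) no_edge.
  have /eqP := conserved y z; rewrite above // no_edge addn_eq0 => /andP[_].
  by case: (c.2 y z).
have no_edge z : (L <= z)%N -> c.2 y z = false.
  by move/no_edge_upto/(_ (leq_addl z X)).
by have := conserved y x; rewrite above // !no_edge ?leqW // addn0 => ->.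
Qed.

Lemma occupation_supported d x :
  (d <= n)%N -> (L <= x)%N -> c.1 (inord d) x = 0%N.
Proof.
move=> le_dn; elim/ind_from_top: d / le_dn x => [x|y IH x le_Lx].
  by rewrite configs_top => /mu_lt.
exact: (proj1 (row_supported IH le_Lx)).
Qed.

Lemma edge_supported (y : 'I_n) x : (L <= x)%N -> c.2 y x = false.
Proof.
move=> le_Lx; apply: (proj2 (row_supported _ le_Lx)) => z.
exact: occupation_supported.
Qed.

Definition rows_of : n.-tuple (L.-tuple bool) :=
  [tuple [tuple c.2 (rev_ord i) x.+1 | x < L] | i < n].

Lemma nth_rows_of (y : 'I_n) x :
  nth false (j :: tnth rows_of (rev_ord y)) x = c.2 y x.
Proof.
rewrite tnth_mktuple rev_ordK; case: x => [|x] /=; first by case: c_configs.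
case: (ltnP x L) => [lt_xL|le_Lx].
  by rewrite (nth_mktuple _ _ (Ordinal lt_xL)).
by rewrite nth_default ?size_tuple ?card_ord // edge_supported // leqW.
Qed.

Lemma below_rows_of d : (d <= n)%N ->
  below_rows j (take (n - d) (map val rows_of)) bs = mkseq (c.1 (inord d)) L.
Proof.
move=> le_dn; elim/ind_from_top: d / le_dn => [|y IH].
  by rewrite subnn take0; apply: eq_mkseq => x; rewrite configs_top.
rewrite -(subnSK (ltn_ord y)) below_rows_take; last first.
  by rewrite size_rows (ltn_ord (rev_ord y)).
rewrite (nth_rows rows_of (rev_ord y)) IH /below size_mkseq.
apply/eq_in_map => x; rewrite mem_iota add0n => /andP[_ lt_xL].
rewrite nth_mkseq // (nth_rows_of y).
have -> : nth false (tnth rows_of (rev_ord y)) x = c.2 y x.+1.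
  exact: nth_rows_of y x.+1.
by rewrite -(conserved y) addnK.
Qed.

Lemma below_rows_of_bottom :
  below_rows j (map val rows_of) bs = occupation L la.
Proof.
have := below_rows_of (leq0n n).
rewrite subn0 take_oversize ?size_rows // => ->.
by apply: eq_mkseq => x; rewrite configs_bottom.
Qed.

Lemma rows_ofK : config_of j bs rows_of = c.
Proof.
rewrite [RHS]surjective_pairing; congr (_, _).
  apply/funext => d; apply/funext => x.
  have le_dn : (d <= n)%N by rewrite -ltnS.
  rewrite below_rows_of // inord_val.
  case: (ltnP x L) => [lt_xL|le_Lx]; first by rewrite nth_mkseq.
  by rewrite nth_default ?size_mkseq // -[d]inord_val occupation_supported.
apply/funext => y; apply/funext => x.
by rewrite (nth_rows rows_of (rev_ord y)) nth_rows_of.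
Qed.

End Encoding.

Lemma configs_sum (u : 'I_n -> F) (f : seq nat -> F) :
  (forall y, regular xi s (u y)) ->
  (forall cs, size cs = L -> f cs = (cs == occupation L la)%:R) ->
  \sum_(c \in @configs n K M la mu j) config_weight q xi s u c =
  foldr (transfer q xi s 0 j) f (codom (u \o @rev_ord n)) bs.
Proof.
move=> ru f_delta; have size_us : size (codom (u \o @rev_ord n)) = n.
  by rewrite size_codom card_ord.
rewrite (foldr_transferE _ _ _ _ _ (size_occupation L mu) size_us).
pose good H := below_rows j (map val H) bs == occupation L la.
pose good_configs := [seq config_of j bs H | H <- enum good].
transitivity (\sum_(c <- good_configs) config_weight q xi s u c).
  rewrite [RHS]fsbig_seq ?(map_inj_uniq (@config_of_inj _ _ _)) ?enum_uniq //.
  symmetry; apply: fsbig_widen => [c /= /mapP[H]|c [c_configs /= c_bad]].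
    by rewrite mem_enum => /eqP /config_of_configs H_configs ->.
  apply: contrapT => /eqP weight_neq0; apply: c_bad.
  have conserved y x := configs_conservation y x ru c_configs weight_neq0.
  apply/mapP; exists (rows_of c); last by rewrite rows_ofK.
  by rewrite mem_enum; apply/eqP; apply: below_rows_of_bottom.
rewrite big_map big_enum_cond big_mkcond; apply: eq_bigr => H _.
rewrite f_delta ?size_below_rows ?size_occupation // -/(good H).
rewrite config_of_weight ?size_occupation // andbT -[H \in good]/(good H).
by case: (good H); [exact/esym/mulr1 | exact/esym/mulr0].
Qed.

End Boundary.
End Configurations.

(** * The formulas for F and G *)

Lemma count_mem_positions x bs y :
  count_mem y (positions x bs) = if (x <= y)%N then nth 0%N bs (y - x) else 0%N.
Proof.
elim: bs x => [|b bs IH] x /=; first by rewrite nth_nil if_same.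
rewrite count_cat count_nseq IH /=; case: (ltngtP x y) => [lt_xy|_|<-].
- by rewrite mul0n add0n -(subnSK lt_xy).
- by rewrite mul0n.
- by rewrite subnn mul1n addn0.
Qed.

Lemma sorted_positions x bs : sorted leq (positions x bs).
Proof.
elim: bs x => // b bs IH x /=; elim: b => [|b IHb]; first exact: IH.
rewrite /= path_sortedE; last exact: leq_trans.
rewrite IHb andbT; apply/allP => y; rewrite mem_cat mem_nseq.
by move=> /orP[/andP[_ /eqP->]//|/positions_ge/ltnW].
Qed.

Section Signatures.
Context (N : nat).
Implicit Types (mu : signature N) (x : nat).

Definition width mu := (\max_(p <- parts mu) p).+1.

Lemma mult_width mu x : (width mu <= x)%N -> mult x mu = 0%N.
Proof.
move=> le_wx; apply/count_memPn; apply: contraL le_wx => mu_x.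
by rewrite -ltnNge ltnS; apply: leq_bigmax_seq.
Qed.

Lemma positions_occupation mu :
  positions 0 (occupation (width mu) mu) = rev (parts mu).
Proof.
apply: (sorted_eq leq_trans anti_leq); first exact: sorted_positions.
  by rewrite rev_sorted; case: mu.
apply/allP => y _; rewrite inE count_mem_positions subn0 nth_occupation.
  by rewrite count_rev.
exact: mult_width.
Qed.

Lemma mult_zeros x : mult x (zeros N) = if x == 0%N then N else 0%N.
Proof. by rewrite /mult count_nseq /= eq_sym; case: eqP; rewrite ?mul1n. Qed.

Lemma occupation_zeros L : occupation L.+1 (zeros N) = N :: nseq L 0%N.
Proof.
rewrite /occupation mkseq_cons mult_zeros; congr (_ :: _).
apply: (@eq_from_nth _ 0%N); rewrite ?size_nseq ?size_mkseq // => i lt_iL.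
by rewrite nth_nseq lt_iL nth_mkseq //= mult_zeros.
Qed.

End Signatures.

Section Formulas.
Context {F : fieldType} (q : F) (xi s : nat -> F).

Lemma admissible_rows n (u : 'I_n -> F) : (forall i, regular xi s (u i)) ->
  (forall a b : 'I_n, a != b -> u a - u b != 0) ->
  admissible xi s (codom (u \o @rev_ord n)).
Proof.
move=> ru distinct; split; last by move=> v /codomP[i ->]; apply: ru.
apply/injectiveP => i j /= /eqP eq_u; apply: rev_ord_inj.
by apply: contraTeq eq_u => /distinct; rewrite subr_eq0.
Qed.

Lemma phi_from0 k : phi_from q xi s 0 k = phi q xi s k.
Proof. by apply/funext => v; rewrite /phi_from big_mkord. Qed.

Lemma phi_positive k v : (0 < k)%N -> regular xi s v ->
  xi 0%N * v - s 0%N != 0 ->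
  phi q xi s k v * (xi 0%N * v / (xi 0%N * v - s 0%N)) =
  xi 0%N * v / den xi s 0 v * phi_from q xi s 1 k v.
Proof.
move=> k_gt0 rv v_neq; rewrite -phi_from0 /phi_from (big_ltn k_gt0).
move: (rv 0%N) (rv k); rewrite /den => d0 dk.
by field; rewrite v_neq d0 dk.
Qed.

Lemma qpochD z l m :
  qpoch z q (l + m) = qpoch z q l * \prod_(i < m) (1 - z * q ^+ (l + i)).
Proof. exact: big_split_ord. Qed.

Lemma Ffun_Bstate M (mu : signature M) (u : 'I_M -> F) :
  (forall i, regular xi s (u i)) ->
  Ffun q xi s mu u =
  Bstate q xi s 0 (codom (u \o @rev_ord M)) (occupation (width mu) mu).
Proof.
move=> ru; apply: (configs_sum q true _ (@mult_width _ mu) (f := @vacuum F) ru).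
  by move=> x _; rewrite mult_zeros if_same.
by move=> bs size_bs; rewrite vacuumE size_bs occupation_zeros.
Qed.

Lemma Ffun_symmetrize M (mu : signature M) (u : 'I_M -> F) :
  (forall i, regular xi s (u i)) ->
  (forall a b : 'I_M, a != b -> u a - u b != 0) ->
  Ffun q xi s mu u =
  symmetrize (fun w => cross q w *
    \prod_(i < M) phi q xi s (nth 0%N (parts mu) i) (w i)) u.
Proof.
move=> ru distinct; rewrite Ffun_Bstate // Bstate_symprod; last first.
  exact: admissible_rows.
rewrite positions_occupation -symmetrize_rev.
rewrite (symmetrize_symprod q (fun i => phi q xi s (nth 0%N (parts mu) i))).
rewrite -[in LHS](mkseq_nth 0%N (parts mu)) size_tuple map_rev -map_comp.
by congr (symprod _ (rev _) _); apply: eq_map => i; rewrite /= phi_from0.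
Qed.

Section GFunction.
Context (n : nat) (nu : signature n) (N : nat) (v : 'I_N -> F).
Context (rv : forall i, regular xi s (v i)).
Let k := mult 0 nu.
Let bs := behead (occupation (width nu) nu).

Lemma occupation_width : occupation (width nu) nu = k :: bs.
Proof. by rewrite /bs /occupation /width mkseq_cons. Qed.

Lemma Gfun_Astate :
  Gfun q xi s nu v = Astate q xi s 0 n (codom (v \o @rev_ord N)) (k :: bs).
Proof.
rewrite -occupation_width.
apply: (configs_sum q false _ (@mult_width _ nu) (f := @stacked F n) rv).
  by move=> x; rewrite mult_zeros; case: x.
case=> // b cs [size_cs].
by rewrite occupation_zeros eqseq_cons /= vacuumE size_cs -mulnb natrM.
Qed.

Lemma Gfun_eq0 : (N < n - k)%N -> Gfun q xi s nu v = 0.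
Proof.
move=> few; rewrite Gfun_Astate -[Astate _ _ _ _ _ _ _]/((_ \o cons k) bs).
by rewrite Astate_eq0 // size_codom card_ord addnC -ltn_subRL.
Qed.

Lemma mult0_le : (k <= n)%N.
Proof. by rewrite -[n in (_ <= n)%N](size_tuple (val nu)) count_size. Qed.

Lemma parts_split : parts nu = rev (positions 1 bs) ++ nseq k 0%N.
Proof.
apply: (can_inj revK); rewrite rev_cat revK rev_nseq -positions_occupation.
by rewrite occupation_width.
Qed.

Lemma size_positive_parts : size (rev (positions 1 bs)) = (n - k)%N.
Proof.
have := congr1 size parts_split.
by rewrite size_tuple size_cat size_nseq => ->; rewrite addnK.
Qed.

Lemma nth_positive_part i : (i < n - k)%N ->
  nth 0%N (parts nu) i = nth 0%N (rev (positions 1 bs)) i.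
Proof.
by move=> lt_i; rewrite parts_split nth_cat size_positive_parts lt_i.
Qed.

Lemma positive_part_gt0 i : (i < n - k)%N -> (0 < nth 0%N (parts nu) i)%N.
Proof.
move=> lt_i; rewrite nth_positive_part //; apply: (@positions_ge 1 bs).
by rewrite -mem_rev mem_nth // size_positive_parts.
Qed.

Lemma nth_zero_part i : (n - k <= i)%N -> nth 0%N (parts nu) i = 0%N.
Proof.
move=> le_i; rewrite parts_split nth_cat size_positive_parts ltnNge le_i /=.
by rewrite nth_nseq if_same.
Qed.

Definition Gfactor i w : F :=
  if (i < n - k)%N
  then xi 0%N * w / den xi s 0 w * phi_from q xi s 1 (nth 0%N (parts nu) i) w
  else (1 - q) * pass_weight q xi s 0 w k.

Lemma rev_Gfactors : (n - k <= N)%N ->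
  rev (mkseq Gfactor N) =
  nseq (N + k - n) (fun w => (1 - q) * pass_weight q xi s 0 w k)
  ++ [seq (fun w => xi 0%N * w / den xi s 0 w * phi_from q xi s 1 y w)
         | y <- positions 1 bs].
Proof.
move=> enough; rewrite -[nseq _ _]revK -[map _ _]revK -rev_cat; congr rev.
rewrite rev_nseq -map_rev; set ys := rev (positions 1 bs).
have size_ys : size ys = (n - k)%N := size_positive_parts.
have size_eq : (size ys + (N + k - n))%N = N.
  rewrite size_ys addnC addnBA ?mult0_le // subnK ?addnK //.
  by rewrite addnC -leq_subLR.
apply: (@eq_from_nth _ id); rewrite size_mkseq.
  by rewrite size_cat size_map size_nseq size_eq.
move=> i lt_iN; rewrite nth_mkseq // nth_cat size_map size_ys /Gfactor.
case: ltnP => [lt_i|le_i].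
  rewrite (nth_map 0%N) ?size_ys //; apply/funext => w.
  by rewrite nth_positive_part.
by rewrite nth_nseq ifT // -(ltn_add2l (size ys)) size_eq size_ys subnKC.
Qed.

Lemma prod_Gfactor w : (forall i, regular xi s (w i)) ->
  ((0 < n - k)%N -> forall i, xi 0%N * w i - s 0%N != 0) ->
  \prod_(i < N) Gfactor i (w i) =
  \prod_(i < N) phi q xi s (nth 0%N (parts nu) i) (w i)
  * \prod_(i < N | (i < n - k)%N) (xi 0%N * w i / (xi 0%N * w i - s 0%N))
  * \prod_(i < N | (n - k <= i)%N) (1 - s 0%N * q ^+ k * xi 0%N * w i).
Proof.
move=> rw w_neq; rewrite [X in _ * X * _]big_mkcond [X in _ * X]big_mkcond.
rewrite -!big_split; apply: eq_bigr => i _; rewrite /Gfactor.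
case: ltnP => [lt_i|le_i] /=.
  rewrite mulr1 phi_positive ?positive_part_gt0 // w_neq //.
  exact: leq_ltn_trans lt_i.
by rewrite mulr1 nth_zero_part // /phi /pass_weight /den big_ord0; ring.
Qed.

Lemma qpoch_Gfun : q != 0 -> (n - k <= N)%N ->
  (forall a b : 'I_N, a != b -> v a - v b != 0) ->
  qpoch q q (N + k - n) * Gfun q xi s nu v =
  (\prod_(i < n - k) (1 - s 0%N ^+ 2 * q ^+ (k + i))) *
  symmetrize (fun w => cross q w * \prod_(i < N) Gfactor i (w i)) v.
Proof.
move=> q_neq0 enough distinct.
have adm_v : admissible xi s (codom (v \o @rev_ord N)).
  exact: admissible_rows.
have size_v : (size (codom (v \o @rev_ord N)) + k = n + (N + k - n))%N.
  by rewrite size_codom card_ord subnKC // addnC -leq_subLR.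
rewrite Gfun_Astate (Astate_symprod 0 bs adm_v q_neq0 size_v mult0_le).
by rewrite -rev_Gfactors // -symmetrize_symprod symmetrize_rev.
Qed.

Lemma Gfun_symmetrize : q != 0 -> (n - k <= N)%N ->
  (forall a b : 'I_N, a != b -> v a - v b != 0) ->
  ((0 < n - k)%N -> forall i, xi 0%N * v i - s 0%N != 0) ->
  qpoch q q (N + k - n) != 0 -> qpoch (s 0%N ^+ 2) q k != 0 ->
  Gfun q xi s nu v =
  qpoch (s 0%N ^+ 2) q n / (qpoch q q (N + k - n) * qpoch (s 0%N ^+ 2) q k) *
  symmetrize (fun w : 'I_N -> F =>
    cross q w *
    \prod_(i < N) phi q xi s (nth 0%N (parts nu) i) (w i) *
    \prod_(i < N | (i < n - k)%N) (xi 0%N * w i / (xi 0%N * w i - s 0%N)) *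
    \prod_(i < N | (n - k <= i)%N) (1 - s 0%N * q ^+ k * xi 0%N * w i)) v.
Proof.
move=> q_neq0 enough distinct v_neq qm_neq0 qk_neq0.
transitivity
  (qpoch (s 0%N ^+ 2) q n / (qpoch q q (N + k - n) * qpoch (s 0%N ^+ 2) q k)
  * symmetrize (fun w => cross q w * \prod_(i < N) Gfactor i (w i)) v).
  apply: (mulfI qm_neq0); rewrite qpoch_Gfun //.
  rewrite -[in qpoch _ _ n](subnKC mult0_le) qpochD.
  by field; rewrite qm_neq0 qk_neq0.
congr (_ * _); apply: eq_bigr => p _; rewrite -!mulrA; congr (_ * _).
rewrite !mulrA prod_Gfactor //.
by move=> positive i; apply: v_neq.
Qed.

End GFunction.
End Formulas.

Theorem theorem4p14 (R : realType) (q : R[i]) (xi s : nat -> R[i])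
    (hq : q != 0) (hxi : forall j, xi j != 0) (hs : forall j, s j != 0) :
  (forall (M : nat) (mu : signature M) (u : 'I_M -> R[i]),
     (forall (x : nat) (i : 'I_M), 1 - s x * xi x * u i != 0) ->
     (forall a b : 'I_M, a != b -> u a - u b != 0) ->
     Ffun q xi s mu u =
     symmetrize (fun w : 'I_M -> R[i] =>
       cross q w * \prod_(i < M) phi q xi s (nth 0%N (parts mu) i) (w i)) u)
  /\
  (forall (n : nat) (nu : signature n) (N : nat) (v : 'I_N -> R[i]),
     let k := mult 0 nu in
     (forall (x : nat) (j : 'I_N), 1 - s x * xi x * v j != 0) ->
     ((n - k <= N)%N ->
      (forall a b : 'I_N, a != b -> v a - v b != 0) ->
      ((0 < n - k)%N -> forall j : 'I_N, xi 0%N * v j - s 0%N != 0) ->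
      qpoch q q (N + k - n) != 0 ->
      qpoch (s 0%N ^+ 2) q k != 0 ->
      Gfun q xi s nu v =
      qpoch (s 0%N ^+ 2) q n /
        (qpoch q q (N + k - n) * qpoch (s 0%N ^+ 2) q k) *
      symmetrize (fun w : 'I_N -> R[i] =>
        cross q w *
        \prod_(j < N) phi q xi s (nth 0%N (parts nu) j) (w j) *
        \prod_(i < N | (i < n - k)%N) (xi 0%N * w i / (xi 0%N * w i - s 0%N)) *
        \prod_(j < N | (n - k <= j)%N) (1 - s 0%N * q ^+ k * xi 0%N * w j)) v)
     /\
     ((N < n - k)%N -> Gfun q xi s nu v = 0)).
Proof.
split=> [M mu u reg_u distinct|n nu N v k reg_v].
  by apply: Ffun_symmetrize => // i x; apply: reg_u.
have rv i : regular xi s (v i) by move=> x; apply: reg_v.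
by split=> [enough distinct v_neq qm_neq0 qk_neq0|few];
  [apply: Gfun_symmetrize | apply: Gfun_eq0].
Qed.
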